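(* Let $\mathbb{K}$ be a field and let $R=\mathbb{K}[x_1,\dots,x_k]$ be graded by $W=[d_1,\dots,d_k]$, where the $d_i$ are positive integers with $\gcd(d_1,\dots,d_k)=1$. Let $d=\operatorname{lcm}(d_1,\dots,d_k)$ and let $P_R^W=\{P_0,\dots,P_{d-1}\}$ be the Hilbert quasi-polynomial of $(R,W)$. Then for every $i=0,\dots,d-1$ the degree of $P_i$ is equal to $k-1$ and its leading coefficient is $$lc(P_i)=\frac{1}{(k-1)!\prod_{i=1}^k d_i}.$$
   Context: The grading by $W$ is $\deg(x_1^{\alpha_1}\cdots x_k^{\alpha_k})=d_1\alpha_1+\cdots+d_k\alpha_k$, and the Hilbert function is $H_R^W(n)=\dim_{\mathbb{K}}(R_n)$. The Hilbert quasi-polynomial of $(R,W)$ is the unique $d$-tuple $\{P_0,\dots,P_{d-1}\}$ of polynomials in $\mathbb{Q}[x]$ such that for all sufficiently large $n$, $H_R^W(n)=P_i(n)$ where $i\in\{0,\dots,d-1\}$, $i\equiv n\bmod d$. *)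

(* Defs.v *)
From HB Require Import structures.
From mathcomp Require Import all_boot all_order all_algebra.
From mathcomp Require Import mpoly.
From Stdlib Require Import ClassicalEpsilon.

Set Implicit Arguments.
Unset Strict Implicit.
Unset Printing Implicit Defensive.

Import GRing.Theory.
Local Open Scope ring_scope.

Definition weight_lcm (k : nat) (W : 'I_k -> nat) : nat :=
  \big[lcmn/1%N]_(i < k) W i.

Definition weight_gcd (k : nat) (W : 'I_k -> nat) : nat :=
  \big[gcdn/0%N]_(i < k) W i.

Definition wdeg (k : nat) (W : 'I_k -> nat) (m : 'X_{1..k}) : nat :=
  (\sum_(i < k) W i * m i)%N.

Lemma wdeg0 k (W : 'I_k -> nat) : wdeg W 0%MM = 0%N.
Proof. by rewrite /wdeg big1 // => i _; rewrite mnm0E muln0. Qed.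

Lemma wdegD k (W : 'I_k -> nat) : {morph wdeg W : m1 m2 / (m1 + m2)%MM >-> (m1 + m2)%N}.
Proof.
by move=> m1 m2; rewrite -big_split; apply: eq_bigr => i _; rewrite mnmDE mulnDr.
Qed.

(* Makes the notation [n.-homog for wdeg W] available. *)
HB.instance Definition _ (k : nat) (W : 'I_k -> nat) :=
  isMeasure.Build k (wdeg W) (wdeg0 W) (@wdegD k W).

(* For a linear subspace S of V, b is a finite K-basis of S. *)
Definition is_basis (K : fieldType) (V : lmodType K) (S : V -> Prop)
    (m : nat) (b : 'I_m -> V) : Prop :=
  [/\ forall i, S (b i),
      forall c : 'I_m -> K, \sum_(i < m) c i *: b i = 0 -> forall i, c i = 0
    & forall v, S v -> exists c : 'I_m -> K, v = \sum_(i < m) c i *: b i].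

Definition has_dim (K : fieldType) (V : lmodType K) (S : V -> Prop) (m : nat) : Prop :=
  exists b : 'I_m -> V, is_basis S b.

Definition graded_piece (K : fieldType) (k : nat) (W : 'I_k -> nat) (n : nat)
    (p : {mpoly K[k]}) : Prop :=
  p \is n.-homog for (wdeg W).

(* dim_K (R_n); [hilbert_functionP] below shows that the choice is determined
   as soon as all weights are positive. *)
Definition hilbert_function (K : fieldType) (k : nat) (W : 'I_k -> nat) (n : nat) : nat :=
  epsilon (inhabits 0%N) (has_dim (@graded_piece K k W n)).

Definition is_hilbert_quasi_polynomial (K : fieldType) (k : nat) (W : 'I_k -> nat)
    (P : 'I_(weight_lcm W) -> {poly rat}) : Prop :=
  exists N : nat, forall (n : nat) (i : 'I_(weight_lcm W)),
    (N <= n)%N -> n = i %[mod weight_lcm W] ->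
    (hilbert_function K W n)%:R = (P i).[n%:R].

Lemma has_dim_le (K : fieldType) (V : lmodType K) (S : V -> Prop) (m1 m2 : nat) :
  has_dim S m1 -> has_dim S m2 -> (m1 <= m2)%N.
Proof.
case=> b1 [S1 free1 _] [b2 [_ _ span2]]; rewrite leqNgt; apply/negP => lt21.
have /fin_all_exists [A hA] i : exists c : 'I_m2 -> K,
  b1 i = \sum_(j < m2) c j *: b2 j by apply: span2.
pose M := \matrix_(i < m1, j < m2) A i j.
have : kermx M != 0.
  by rewrite kermx_eq0 /row_free neq_ltn (leq_ltn_trans (rank_leq_col M) lt21).
case/rowV0Pn => u /sub_kermxP uM /eqP; case; apply/rowP => i; rewrite mxE.
move: i; apply: free1.
under eq_bigr do rewrite hA scaler_sumr.
rewrite exchange_big big1 //= => j _.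
under eq_bigr do rewrite scalerA.
rewrite -scaler_suml; have /rowP/(_ j) := uM; rewrite !mxE => uMj.
rewrite [X in X *: _](_ : _ = 0) ?scale0r // -[RHS]uMj.
by apply: eq_bigr => i _; rewrite mxE.
Qed.

Lemma mdeg_le_wdeg k (W : 'I_k -> nat) (m : 'X_{1..k}) :
  (forall i, 0 < W i)%N -> (mdeg m <= wdeg W m)%N.
Proof. by move=> W0; rewrite mdegE; apply: leq_sum => i _; apply: leq_pmull. Qed.

Lemma graded_piece_has_dim (K : fieldType) k (W : 'I_k -> nat) (n : nat) :
  (forall i, 0 < W i)%N -> exists m, has_dim (@graded_piece K k W n) m.
Proof.
move=> W0; pose A := [set m : 'X_{1..k < n.+1} | wdeg W m == n].
exists #|A|, (fun i : 'I_#|A| => 'X_[bmnm (enum_val i)]); split.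
- move=> i; rewrite /graded_piece dhomogX.
  by have := enum_valP i; rewrite inE.
- move=> c c0 i.
  have := congr1 (mcoeff (bmnm (enum_val i))) c0.
  rewrite mcoeff0 linear_sum (bigD1 i) //= big1 => [|j ji].
    by rewrite mcoeffZ mcoeffX eqxx mulr1 addr0.
  rewrite mcoeffZ mcoeffX (inj_eq val_inj) (inj_eq enum_val_inj) (negPf ji).
  by rewrite mulr0.
- move=> p hp; exists (fun i => p@_(bmnm (enum_val i))).
  rewrite -[LHS](pihomog_dE hp) (@pihomogwE k K (wdeg W) n n.+1); last first.
    rewrite msizeE; apply/bigmax_leqP_seq => m mp _.
    by rewrite ltnS -(dhomog_mf hp mp) mdeg_le_wdeg.
  rewrite (eq_bigl (mem A)) => [|m]; last by rewrite !inE.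
  by rewrite big_enum_val.
Qed.

Lemma hilbert_functionP (K : fieldType) k (W : 'I_k -> nat) (n m : nat) :
  (forall i, 0 < W i)%N ->
  has_dim (@graded_piece K k W n) m <-> hilbert_function K W n = m.
Proof.
move=> W0; have H := epsilon_spec (inhabits 0%N) _ (graded_piece_has_dim K n W0).
split=> [Hm|<- //]; apply/eqP; rewrite eqn_leq.
by rewrite !(has_dim_le _ Hm, has_dim_le Hm).
Qed.

(* Main.v *)
Require Import Defs.
From mathcomp Require Import all_boot all_order all_algebra.
From mathcomp Require Import mpoly.

Set Implicit Arguments.
Unset Strict Implicit.
Unset Printing Implicit Defensive.

Import GRing.Theory Num.Theory.
Local Open Scope ring_scope.

(** The number of monomials of weighted degree n is the number of solutions
    alpha of W_0 alpha_0 + ... + W_(k-1) alpha_(k-1) = n, whatever the field K.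
    Let d be the lcm of the weights, and divide each exponent with remainder:
    alpha_j = (d / W_j) q_j + r_j with 0 <= r_j < d / W_j.  The equation becomes
    s + d (q_0 + ... + q_(k-1)) = n, where s is the weighted degree of r.  So,
    for each r in this finite box with s <= n and s = n mod d, there are
    C((n - s)/d + k - 1, k - 1) solutions.  In terms of generating functions,
<<
      1 / prod_j (1 - X^(W_j)) = Q(X) / (1 - X^d)^k,
      Q(X) = prod_j (1 + X^(W_j) + ... + X^(d - W_j)),
>>
    and the lemma [hilbert_function_box] is the resulting formula
<<
      H(n) = sum over s <= n, s = n mod d, of Q_s * C((n - s)/d + k - 1, k - 1).
>>
    Each binomial coefficient is a polynomial in n of degree k - 1 with leading
    coefficient 1 / ((k-1)! d^(k-1)) ([shifted_bin_poly]).  Hence P_i, which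
    agrees with the formula for all large n = i mod d, has degree at most k - 1,
    and its coefficient of degree k - 1 is c_i / ((k-1)! d^(k-1)), where c_i is
    the sum of the Q_s over s = i mod d.

    It remains to see that c_i does not depend on i, and this is where the gcd
    hypothesis enters.  Since (X^(W_j) - 1) Q is a multiple of X^d - 1, the
    function i |-> c_i has every W_j as a period, hence also their gcd, which
    is 1.  As the c_i for 0 <= i < d add up to Q(1) = prod_j (d / W_j), each of
    them equals prod_j (d / W_j) / d = d^(k-1) / prod_j W_j ([class_sum_box]).
    The quotient is then 1 / ((k-1)! prod_j W_j), which is not 0, so the degree
    is exactly k - 1. *)

(** * Truncated geometric series *)

Definition geom_poly (a N : nat) : {poly rat} := \sum_(r < N) 'X^a ^+ r.

Lemma geom_polyM1 a N : ('X^a - 1) * geom_poly a N = 'X^(a * N) - 1.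
Proof. by rewrite exprM [RHS]subrX1. Qed.

(** Division with remainder of the exponents r < b * M by b, as a factorization
    of their generating polynomial. *)
Lemma geom_poly_mul a b M : (0 < a)%N ->
  geom_poly a (b * M) = geom_poly a b * geom_poly (a * b) M.
Proof.
move=> a_gt0; have nz : ('X^a - 1 : {poly rat}) != 0.
  by rewrite -size_poly_eq0 size_XnsubC.
by apply: (mulfI nz); rewrite mulrA !geom_polyM1 mulnA.
Qed.

Lemma geom_poly_comp d L : geom_poly d L = geom_poly 1 L \Po 'X^d.
Proof.
rewrite /geom_poly rmorph_sum; apply: eq_bigr => i _ /=.
by rewrite rmorphXn /= expr1 comp_polyX.
Qed.

Lemma hockey_stick m k :
  (\sum_(j < m.+1) 'C(j + k, k) = 'C(m + k.+1, k.+1))%N.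
Proof.
elim: m => [|m IH]; first by rewrite big_ord_recr big_ord0 /= !add0n !binn.
by rewrite big_ord_recr /= IH !addSn [RHS]binS addnS.
Qed.

(** Stars and bars: for m below all truncation orders, the coefficient is that
    of 1 / (1 - X)^(k+1).  Letting the order L j depend on the factor is what
    allows one common bound on all the exponents later on. *)
Lemma coef_prod_geom_poly k (L : 'I_k.+1 -> nat) m :
  (forall j, m < L j)%N ->
  (\prod_j geom_poly 1 (L j))`_m = 'C(m + k, k)%:R.
Proof.
have geomE N : geom_poly 1 N = \poly_(i < N) 1.
  by rewrite poly_def; apply: eq_bigr => i _; rewrite expr1 scale1r.
elim: k L m => [|k IH] L m mL.
  by rewrite big_ord1 geomE coef_poly mL bin0.
rewrite big_ord_recr coefM -hockey_stick natr_sum; apply: eq_bigr => j _.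
have jm : (j <= m)%N by rewrite -ltnS.
rewrite IH => [|i]; last exact: leq_ltn_trans jm (mL _).
by rewrite geomE coef_poly (leq_ltn_trans (leq_subr j m) (mL _)) mulr1.
Qed.

(** * The Hilbert function as a coefficient *)

Lemma coef_prod_geom_poly_card k (W : 'I_k -> nat) N n :
  (\prod_j geom_poly (W j) N)`_n =
    #|[set f : {ffun 'I_k -> 'I_N} | \sum_j W j * f j == n]%N|%:R.
Proof.
rewrite /geom_poly bigA_distr_bigA coef_sum -sum1_card natr_sum big_mkcond.
rewrite [RHS]big_mkcond; apply: eq_bigr => f _ /=.
rewrite (_ : \prod_i _ = 'X^(\sum_j W j * f j)%N); last first.
  by rewrite -prodrXr; apply: eq_bigr => j _; rewrite exprM.
by rewrite coefXn inE eq_sym; case: eqP.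
Qed.

(** The monomials of weighted degree n form a basis of the n-th graded piece.
    As the weights are positive, their exponents are at most n, so any bound
    N > n gives all of them. *)
Lemma hilbert_function_card (K : fieldType) k (W : 'I_k -> nat) n N :
  (forall j, 0 < W j)%N -> (n < N)%N ->
  hilbert_function K W n =
    #|[set f : {ffun 'I_k -> 'I_N} | \sum_j W j * f j == n]%N|.
Proof.
move=> W_gt0 nN; apply/hilbert_functionP => //.
set A := [set f | _]; pose mon (f : {ffun 'I_k -> 'I_N}) : 'X_{1..k} :=
  [multinom (f j : nat) | j < k].
have mon_inj : injective mon.
  move=> f g /mnmP fg; apply/ffunP=> j; apply/val_inj.
  by have := fg j; rewrite !mnmE.
have wdeg_mon f : wdeg W (mon f) = (\sum_j W j * f j)%N.
  by apply: eq_bigr => j _; rewrite mnmE.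
have coef_mon (c : 'I_#|A| -> K) i :
    (\sum_i c i *: 'X_[mon (enum_val i)])@_(mon (enum_val i)) = c i.
  rewrite linear_sum (bigD1 i) //= big1 => [|j ji].
    by rewrite mcoeffZ mcoeffX eqxx mulr1 addr0.
  rewrite mcoeffZ mcoeffX (inj_eq mon_inj) (inj_eq enum_val_inj) (negPf ji).
  by rewrite mulr0.
exists (fun i => 'X_[mon (enum_val i)]); split=> [i|c c0 i|p hp].
- rewrite /graded_piece dhomogX [X in X == _]wdeg_mon.
  by have := enum_valP i; rewrite inE.
- by rewrite -coef_mon c0 mcoeff0.
exists (fun i => p@_(mon (enum_val i))); apply/mpolyP => m.
have [[i ->]|not_mon] : (exists i : 'I_#|A|, m = mon (enum_val i)) \/
    (forall i : 'I_#|A|, m != mon (enum_val i)).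
- case: (pickP (fun i : 'I_#|A| => m == mon (enum_val i))) => [i /eqP|no].
    by left; exists i.
  by right=> i; rewrite no.
- by rewrite coef_mon.
rewrite linear_sum big1 => [|i _]; last first.
  by rewrite /= mcoeffZ mcoeffX eq_sym (negPf (not_mon i)) mulr0.
apply: memN_msupp_eq0; apply/negP=> /(dhomog_mf hp) wm.
have mN j : (m j < N)%N.
  apply: leq_ltn_trans nN; rewrite -wm /= /wdeg (bigD1 j) //=.
  by apply: leq_trans (leq_addr _ _); rewrite leq_pmull.
pose f : {ffun 'I_k -> 'I_N} := [ffun j => Ordinal (mN j)].
have mE : m = mon f by apply/mnmP=> j; rewrite mnmE ffunE.
have fA : f \in A by rewrite inE -wdeg_mon -mE; apply/eqP.
by have := not_mon (enum_rank_in fA f); rewrite enum_rankK_in // mE eqxx.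
Qed.

(** The numerator Q of the Hilbert series written over (1 - X^d)^k. *)
Definition box_poly k (W : 'I_k -> nat) : {poly rat} :=
  \prod_j geom_poly (W j) (weight_lcm W %/ W j).

Lemma dvdn_weight_lcm k (W : 'I_k -> nat) j : (W j %| weight_lcm W)%N.
Proof. exact: biglcmn_sup. Qed.

(** The Hilbert series is Q(X) / (1 - X^d)^k; only the exponents n - s divisible
    by d occur in the expansion of the denominator. *)
Lemma hilbert_function_box (K : fieldType) k (W : 'I_k.+1 -> nat) n :
  (forall j, 0 < W j)%N ->
  let d := weight_lcm W in
  (hilbert_function K W n)%:R =
    \sum_(s < n.+1 | (d %| n - s)%N)
      (box_poly W)`_s * 'C((n - s) %/ d + k, k)%:R :> rat.
Proof.
move=> W_gt0 d; have d_gt0 : (0 < d)%N.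
  by rewrite /d /weight_lcm; elim/big_ind: _ => // x y; rewrite lcmn_gt0 => ->.
have dW j : (W j * (d %/ W j) = d)%N by rewrite mulnC divnK ?dvdn_weight_lcm.
(* A common bound on the exponents that is a multiple of every d / W j. *)
rewrite (@hilbert_function_card _ _ _ _ (d * n.+1)) ?leq_pmull //.
rewrite -coef_prod_geom_poly_card.
have -> : \prod_j geom_poly (W j) (d * n.+1) =
    box_poly W * ((\prod_j geom_poly 1 (W j * n.+1)) \Po 'X^d).
  rewrite rmorph_prod -big_split; apply: eq_bigr => j _ /=.
  have -> : (d * n.+1 = d %/ W j * (W j * n.+1))%N.
    by rewrite mulnA divnK ?dvdn_weight_lcm.
  by rewrite geom_poly_mul // dW -geom_poly_comp.
rewrite coefM [RHS]big_mkcond; apply: eq_bigr => s _ /=.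
rewrite coef_comp_poly_Xn //; case: ifP => _; last by rewrite mulr0.
rewrite coef_prod_geom_poly // => j.
apply: leq_trans (leq_pmull _ (W_gt0 j)); rewrite ltnS.
by apply: leq_trans (leq_subr s n); apply: leq_div.
Qed.

(** * Sums of coefficients along residue classes *)

(** For 0 <= n < d, the coefficient of degree n of p reduced modulo X^d - 1. *)
Definition class_sum (R : nzRingType) (d : nat) (p : {poly R}) (n : nat) : R :=
  \sum_(s < size p | s == n %[mod d]) p`_s.

Lemma class_sum_widen (R : nzRingType) d (p : {poly R}) n N : (size p <= N)%N ->
  class_sum d p n = \sum_(s < N | s == n %[mod d]) p`_s.
Proof.
move=> pN; rewrite /class_sum.
rewrite (big_ord_widen_cond N (fun s => s == n %[mod d])) //.
rewrite big_mkcondr; apply: eq_bigr => s _; case: ltnP => // sp.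
by rewrite nth_default.
Qed.

Lemma class_sumB (R : nzRingType) d (p q : {poly R}) n :
  class_sum d (p - q) n = class_sum d p n - class_sum d q n.
Proof.
pose N := maxn (size (p - q)) (maxn (size p) (size q)).
rewrite !(@class_sum_widen _ d _ n N) ?leq_max ?leqnn ?orbT // -sumrB.
by apply: eq_bigr => s _; rewrite coefB.
Qed.

Lemma class_sumXn (R : nzRingType) d e (p : {poly R}) n :
  class_sum d ('X^e * p) (e + n) = class_sum d p n.
Proof.
rewrite (@class_sum_widen _ d ('X^e * p) _ (e + size p)); last first.
  have [->|p0] := eqVneq p 0; first by rewrite mulr0 size_poly0.
  by rewrite -commr_polyXn size_mulXn // leq_add.
rewrite big_mkcond big_split_ord /= big1 ?add0r => [|s _]; last first.
  by rewrite coefXnM ltn_ord if_same.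
rewrite /class_sum [RHS]big_mkcond; apply: eq_bigr => s _ /=.
by rewrite eqn_modDl coefXnM ltnNge leq_addr /= addKn.
Qed.

Lemma class_sumDd (R : nzRingType) d (p : {poly R}) n :
  class_sum d p (d + n) = class_sum d p n.
Proof. by apply: eq_bigl => s; rewrite modnDl. Qed.

Lemma sum_class_sum (R : nzRingType) d (p : {poly R}) : (0 < d)%N ->
  \sum_(n < d) class_sum d p n = p.[1].
Proof.
move=> d_gt0; rewrite horner_coef.
under eq_bigr => n _ do rewrite /class_sum big_mkcond /=.
rewrite exchange_big /=; apply: eq_bigr => s _; rewrite expr1n mulr1.
rewrite (bigD1 (Ordinal (ltn_pmod s d_gt0))) //= modn_mod eqxx big1 ?addr0 //.
move=> n; rewrite -val_eqE /= eq_sym => /negPf.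
by rewrite (modn_small (ltn_ord n)) => ->.
Qed.

(** Write the Bezout identity as u * a = v * b + gcd with u and v natural
    numbers: moving n + gcd by v periods b reaches n + u * a. *)
Lemma period_gcd T (f : nat -> T) a b :
  (forall n, f (a + n)%N = f n) -> (forall n, f (b + n)%N = f n) ->
  forall n, f (gcdn a b + n)%N = f n.
Proof.
move=> fa fb n.
have [->|a_gt0] := posnP a; first by rewrite gcd0n fb.
have mul c : (forall n, f (c + n)%N = f n) ->
    forall u n, f (u * c + n)%N = f n.
  by move=> fc; elim=> [|u IH] m; rewrite ?add0n // mulSn -addnA fc IH.
case: (egcdnP b a_gt0) => u v uv _.
by rewrite -(mul b fb v) addnA -uv (mul a fa).
Qed.

Lemma period_weight_gcd T (f : nat -> T) k (W : 'I_k -> nat) :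
  (forall j n, f (W j + n)%N = f n) -> forall n, f (weight_gcd W + n)%N = f n.
Proof.
move=> fW; rewrite /weight_gcd; elim/big_ind: _ => // a b; exact: period_gcd.
Qed.

(** Modulo X^d - 1, multiplication by X^(W j) leaves Q unchanged: the j-th
    factor of Q is (X^d - 1) / (X^(W j) - 1). *)
Lemma class_sum_box_period k (W : 'I_k -> nat) j n :
  class_sum (weight_lcm W) (box_poly W) (W j + n) =
  class_sum (weight_lcm W) (box_poly W) n.
Proof.
set d := weight_lcm W; set Q := box_poly W.
pose R := \prod_(i < k | i != j) geom_poly (W i) (d %/ W i).
have QE : 'X^(W j) * Q - Q = 'X^d * R - R.
  rewrite -[X in _ - X]mul1r -mulrBl /Q /box_poly (bigD1 j) //= mulrA.
  by rewrite geom_polyM1 mulnC divnK ?dvdn_weight_lcm // mulrBl mul1r.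
apply/esym/eqP; rewrite -subr_eq0 -(class_sumXn d (W j) Q) -class_sumB QE.
by rewrite class_sumB -(class_sumDd d ('X^d * R)) class_sumXn subrr.
Qed.

(** The d class sums of Q are equal, since 1 is a period, and they add up to
    Q(1), the number of points of the box. *)
Lemma class_sum_box k (W : 'I_k -> nat) n :
  (0 < weight_lcm W)%N -> weight_gcd W = 1%N ->
  class_sum (weight_lcm W) (box_poly W) n =
    (\prod_j (weight_lcm W %/ W j))%:R / (weight_lcm W)%:R.
Proof.
set d := weight_lcm W; set Q := box_poly W => d_gt0 W_gcd.
have cst m : class_sum d Q m = class_sum d Q 0.
  elim: m => // m <-; rewrite -add1n -[in LHS]W_gcd.
  exact: (period_weight_gcd (f := class_sum d Q) (@class_sum_box_period k W)).
have Q1 : Q.[1] = (\prod_j (d %/ W j))%:R.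
  rewrite /Q /box_poly horner_prod natr_prod; apply: eq_bigr => j _.
  rewrite horner_sum (eq_bigr (fun=> 1)) => [|i _]; last first.
    by rewrite !hornerE !expr1n.
  by rewrite sumr_const card_ord.
rewrite -Q1 -(sum_class_sum Q d_gt0) (eq_bigr (fun=> class_sum d Q n)).
  rewrite sumr_const card_ord -[_ *+ d]mulr_natr mulfK //.
  by rewrite pnatr_eq0 -lt0n.
by move=> i _; rewrite cst [RHS]cst.
Qed.

(** * Binomial coefficients as polynomials *)

(** The polynomial C((X - s)/d + k, k), with the factors (X - s)/d + t + 1 made
    monic, so that the leading coefficient is the scalar in front. *)
Definition shifted_bin_poly (d k s : nat) : {poly rat} :=
  ((k`! * d ^ k)%N%:R)^-1 *:
    \prod_(t < k) ('X - (s%:R - (d * t.+1)%:R)%:P).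

Lemma shifted_bin_polyE d k s m : (0 < d)%N ->
  (shifted_bin_poly d k s).[(s + d * m)%:R] = 'C(m + k, k)%:R.
Proof.
move=> d_gt0; have nz : (k`! * d ^ k)%N%:R != 0 :> rat.
  by rewrite pnatr_eq0 -lt0n muln_gt0 fact_gt0 expn_gt0 d_gt0.
apply: (mulfI nz); rewrite /shifted_bin_poly hornerZ mulVKf //.
rewrite horner_prod -natrM.
have -> : (k`! * d ^ k * 'C(m + k, k) = \prod_(t < k) (d * (m + t.+1)))%N.
  rewrite mulnAC [(k`! * _)%N]mulnC bin_ffact mulnC.
  rewrite big_split /= prod_nat_const card_ord; congr (_ * _)%N.
  elim: k {nz} => [|k IH]; first by rewrite ffactn0 big_ord0.
  by rewrite big_ord_recr -IH addnS ffactnS /= mulnC.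
rewrite natr_prod; apply: eq_bigr => t _.
by rewrite hornerXsubC opprB mulnDr !natrD [LHS]addrC [LHS]addrA subrK addrC.
Qed.

Lemma coef_shifted_bin_poly d k s :
  (shifted_bin_poly d k s)`_k = ((k`! * d ^ k)%N%:R)^-1.
Proof.
rewrite /shifted_bin_poly coefZ; set p := \prod_(t < k) _.
have p_monic : p \is monic by apply: monic_prod_XsubC.
have sp : size p = k.+1.
  by rewrite size_prod_XsubC /index_enum -enumT size_enum_ord.
by move/monicP: p_monic; rewrite lead_coefE sp => ->; rewrite mulr1.
Qed.

Lemma size_shifted_bin_poly d k s : (size (shifted_bin_poly d k s) <= k.+1)%N.
Proof.
apply: leq_trans (size_scale_leq _ _) _.
by rewrite size_prod_XsubC /index_enum -enumT size_enum_ord.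
Qed.

Lemma eq_poly_on_class (R : numDomainType) (p q : {poly R}) d i N : (0 < d)%N ->
  (forall n, (N <= n)%N -> n = i %[mod d] -> p.[n%:R] = q.[n%:R]) -> p = q.
Proof.
move=> d_gt0 pq; apply/eqP; rewrite -subr_eq0; apply/eqP.
pose pt t := ((i + d * (N + t))%N%:R : R).
apply: (@roots_geq_poly_eq0 R _ [seq pt t | t <- iota 0 (size (p - q))]).
- apply/allP=> _ /mapP[t _ ->]; rewrite /root hornerD hornerN subr_eq0 pq //.
    apply: leq_trans (leq_addl _ _).
    by apply: leq_trans (leq_pmull _ d_gt0); apply: leq_addr.
  by rewrite mulnC addnC modnMDl.
- rewrite map_inj_uniq ?iota_uniq // => t u /eqP.
  by rewrite eqr_nat eqn_add2l eqn_pmul2l // eqn_add2l => /eqP.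
- by rewrite size_map size_iota.
Qed.

(** * The leading term of the Hilbert quasi-polynomial *)

Theorem proposition12 (K : fieldType) (k : nat) (W : 'I_k -> nat)
    (W_gt0 : forall j : 'I_k, (0 < W j)%N)
    (W_gcd : weight_gcd W = 1%N)
    (P : 'I_(weight_lcm W) -> {poly rat})
    (P_hilbert : is_hilbert_quasi_polynomial K P)
    (i : 'I_(weight_lcm W)) :
  size (P i) = k.-1.+1 /\
  lead_coef (P i) = 1 / ((k.-1)`! * \prod_(j < k) W j)%N%:R.
Proof.
case: k W W_gt0 W_gcd P P_hilbert i => [|k] W W_gt0 W_gcd P P_hilbert i.
  by move: W_gcd; rewrite /weight_gcd big_ord0.
rewrite /=; set d := weight_lcm W in P P_hilbert i *.
have d_gt0 : (0 < d)%N by apply: leq_ltn_trans (ltn_ord i).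
pose Q := box_poly W.
pose F := \sum_(s < size Q | s == i %[mod d]) Q`_s *: shifted_bin_poly d k s.
(* From size Q on, the sum over s <= n of the formula for H n is complete. *)
have PF : P i = F.
  case: P_hilbert => N HN.
  apply: (@eq_poly_on_class _ _ _ d i (N + size Q)) => // n Nn ni.
  rewrite -HN //; last exact: leq_trans (leq_addr _ _) Nn.
  have Qn : (size Q <= n.+1)%N.
    by apply: leqW; apply: leq_trans (leq_addl _ _) Nn.
  rewrite hilbert_function_box // -/d -/Q /F horner_sum.
  rewrite (big_ord_widen_cond n.+1 (fun s => s == i %[mod d])
            (fun s => (Q`_s *: shifted_bin_poly d k s).[n%:R])) // big_mkcondr.
  apply: eq_big => [s|s]; have sn : (s <= n)%N by rewrite -ltnS.
    by rewrite -ni eq_sym eqn_mod_dvd.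
  move=> /divnK ns; case: ltnP => sQ; last by rewrite nth_default ?mul0r.
  rewrite hornerZ; congr (_ * _).
  by rewrite -(shifted_bin_polyE _ s _ d_gt0) mulnC ns subnKC.
have Fk : F`_k = 1 / (k`! * \prod_(j < k.+1) W j)%N%:R.
  rewrite /F coef_sum (eq_bigr (fun s : 'I__ => Q`_s * (k`! * d ^ k)%N%:R^-1)).
    rewrite -mulr_suml -[X in X * _]/(class_sum d Q i) class_sum_box //.
    have dE : ((\prod_j (d %/ W j)) * \prod_j W j = d * d ^ k)%N.
      rewrite -big_split /= -expnS -[k.+1 in RHS]card_ord -prod_nat_const.
      by apply: eq_bigr => j _; rewrite divnK ?dvdn_weight_lcm.
    have nz m : (0 < m)%N -> m%:R != 0 :> rat by rewrite pnatr_eq0 -lt0n.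
    apply/eqP; rewrite -mulrA -invfM -natrM eqr_div ?nz //; last first.
    - by rewrite muln_gt0 fact_gt0 prodn_gt0.
    - by rewrite !muln_gt0 d_gt0 fact_gt0 expn_gt0 d_gt0.
    by rewrite mul1r -natrM mulnCA dE mulnCA.
  by move=> s _; rewrite coefZ coef_shifted_bin_poly.
have sF : (size F <= k.+1)%N.
  apply: leq_trans (size_sum _ _ _) _; apply/bigmax_leqP => s _.
  exact: leq_trans (size_scale_leq _ _) (size_shifted_bin_poly _ _ _).
have Fk_neq0 : F`_k != 0.
  by rewrite Fk div1r invr_eq0 pnatr_eq0 -lt0n muln_gt0 fact_gt0 prodn_gt0 //.
have {}sF : size F = k.+1.
  apply/eqP; rewrite eqn_leq sF ltnNge; apply: contra Fk_neq0 => sk.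
  by rewrite nth_default.
by rewrite PF lead_coefE sF.
Qed.
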